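(* Let $(X,d)$ be a complete metric space and let $G$ be a reflexive digraph with vertex set $V(G)=X$ and edge set $E(G)$. Let $F: X\times X \rightarrow X$ be a continuous mapping having the mixed $G$-monotone property on $X$. Assume there exists $k < 1$ such that $$d(F(x,y), F(u,v)) \leq \frac{k}{2} \Big[d(x,u) + d(y,v)\Big]$$ for any $(x,y), (u,v) \in X\times X$ such that $\big((x,y), (u,v)\big) \in E(G)$. If there exist $x_0, y_0 \in X$ such that $\big((x_0,y_0), (F(x_0,y_0),F(y_0,x_0))\big) \in E(G)$, then there exists a coupled fixed point $(x,y)\in X\times X$ of $F$, i.e. $F(x,y) =x$ and $F(y,x) = y$.
   Context: A reflexive digraph $G$ on $X$ is a directed graph with vertex set $V(G)=X$ and no parallel edges, so that its edge set is a subset $E(G)\subseteq X\times X$, such that $(x,x)\in E(G)$ for every $x\in X$. The graph $G$ on $X$ induces a graph on $X\times X$, still denoted by $G$: for $(x,y),(u,v)\in X\times X$, $$\big((x,y),(u,v)\big)\in E(G) \iff (x,u)\in E(G) \text{ and } (v,y)\in E(G).$$ A mapping $F:X\times X\to X$ has the mixed $G$-monotone property if (1) for all $x_1,x_2,y\in X$: $(x_1,x_2)\in E(G)$ implies $(F(x_1,y),F(x_2,y))\in E(G)$; and (2) for all $x,y_1,y_2\in X$: $(y_1,y_2)\in E(G)$ implies $(F(x,y_2),F(x,y_1))\in E(G)$. *)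

(* Defs.v *)
From HB Require Import structures.
From mathcomp Require Import all_boot all_order all_algebra.
From mathcomp Require Import all_classical all_reals.
From mathcomp Require Import topology.

Set Implicit Arguments.
Unset Strict Implicit.
Unset Printing Implicit Defensive.

Local Open Scope classical_set_scope.
Local Open Scope ring_scope.

(* A complete space of the library is pointed, hence nonempty.  *)
#[short(type="completeMetricType")]
HB.structure Definition CompleteMetric (R : numDomainType) :=
  {T of Complete T & Metric R T}.

Record reflexive_digraph (X : Type) := ReflexiveDigraph {
  edges : set (X * X) ;
  edges_refl : forall x, edges (x, x)
}.

Section Digraph.
Context {X : Type}.

(* The second coordinate is compared in the reverse direction. *)
Definition prod_edges (G : reflexive_digraph X) : set ((X * X) * (X * X)) :=
  [set e | edges G (e.1.1, e.2.1) /\ edges G (e.2.2, e.1.2)].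

Lemma prod_edges_refl (G : reflexive_digraph X) (p : X * X) :
  prod_edges G (p, p).
Proof. by split; exact: edges_refl. Qed.

Definition prod_digraph (G : reflexive_digraph X) : reflexive_digraph (X * X) :=
  ReflexiveDigraph (prod_edges_refl G).

Definition mixed_monotone (G : reflexive_digraph X) (F : X * X -> X) : Prop :=
  (forall x1 x2 y, edges G (x1, x2) -> edges G (F (x1, y), F (x2, y))) /\
  (forall x y1 y2, edges G (y1, y2) -> edges G (F (x, y2), F (x, y1))).

Definition coupled_fixed_point (F : X * X -> X) (p : X * X) : Prop :=
  F (p.1, p.2) = p.1 /\ F (p.2, p.1) = p.2.

End Digraph.

(* Main.v *)
Require Import Defs.
From mathcomp Require Import all_boot all_order all_algebra.
From mathcomp Require Import all_classical all_reals.
From mathcomp Require Import topology.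
From mathcomp Require Import normedtype sequences lra ring.

(** The map [T (x, y) = (F (x, y), F (y, x))] on the product has the coupled
    fixed points of [F] as its fixed points, so one wants to run the Picard
    iteration of [T] from [p0 = (x0, y0)].

    The edge relation is not transitive, so [T] need not send edges to edges:
    from an edge between [(x, y)] and [(u, v)] mixed monotonicity only gives a
    walk of two edges, through [(F (u, y), F (y, u))], obtained by moving first
    [x] to [u] and then [y] to [v].  This detour costs nothing.  In the sum
    metric the first edge has length at most [k * d (x, u)] and the second at
    most [k * d (y, v)], because each of them comes from a step that moves a
    single coordinate.  Together they are no longer than [k] times the original
    edge ([coupled_map_edge]).  So although the number of edges doubles at each
    step, [T] contracts the total length of walks by [k] ([coupled_map_walk]),
    and the triangle inequality gives
    [d (T^n p0, T^(n+1) p0) <= k ^ n * d (p0, T p0)].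

    The rest is the Banach argument: both coordinates of the iterates are
    Cauchy ([geometric_steps_cvg]), and continuity of [F] passes the recursion
    to their limits. *)

Set Implicit Arguments.
Unset Strict Implicit.
Unset Printing Implicit Defensive.

Import Order.TTheory GRing.Theory Num.Theory.
Import numFieldNormedType.Exports.

Local Open Scope classical_set_scope.
Local Open Scope ring_scope.

(** The geometric sum is kept multiplied by [1 - q], which makes the induction
    on [m] a plain polynomial identity. *)
Lemma geometric_steps_dist (R : realFieldType) (X : metricType R) (u : nat -> X)
    (q L : R) (q1 : q < 1)
    (step : forall n, mdist (u n) (u n.+1) <= L * q ^+ n) n m :
  (1 - q) * mdist (u n) (u (n + m)%N) <= L * q ^+ n * (1 - q ^+ m).
Proof.
elim: m => [|m IH]; first by rewrite addn0 mdistxx expr0 subrr !mulr0.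
have tri := metric_triangle (u n) (u (n + m)%N) (u (n + m).+1).
have q1' : 0 <= 1 - q by rewrite subr_ge0 ltW.
rewrite addnS (le_trans (ler_wpM2l q1' tri))// mulrDr.
rewrite (le_trans (lerD IH (ler_wpM2l q1' (step (n + m)%N))))//.
by rewrite exprD exprS le_eqVlt; apply/orP; left; apply/eqP; ring.
Qed.

Lemma geometric_steps_cvg (R : realType) (X : completeMetricType R)
    (u : nat -> X) (q L : R) (q0 : 0 <= q) (q1 : q < 1)
    (step : forall n, mdist (u n) (u n.+1) <= L * q ^+ n) :
  exists l : X, u @ \oo --> l.
Proof.
have L0 : 0 <= L.
  by have := le_trans (mdist_ge0 _ _) (step 0%N); rewrite expr0 mulr1.
suff /cauchy_cvg uc : cauchy (u @ \oo) by exists (lim (u @ \oo)).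
apply: cauchy_exP => e e0.
have eq0 : 0 < e * (1 - q) by rewrite mulr_gt0// subr_gt0.
have [N _ small] : \forall n \near \oo, L * q ^+ n < e * (1 - q).
  have : geometric L q @ \oo --> (0 : R).
    by apply: cvg_geometric; rewrite ger0_norm.
  by move=> /cvgr_lt; apply.
exists (u N); exists N => // n /= Nn.
rewrite ballEmdist /= -(subnKC Nn).
have := geometric_steps_dist q1 step N (n - N).
have : L * q ^+ N * (1 - q ^+ (n - N)) <= L * q ^+ N.
  by rewrite ler_piMr ?mulr_ge0 ?exprn_ge0// lerBlDr lerDl exprn_ge0.
move=> /[swap] /le_trans /[apply] /le_lt_trans /(_ (small _ (leqnn N))).
by rewrite [e * _]mulrC ltr_pM2l// subr_gt0.
Qed.

Section CoupledMap.
Context {R : realType} {X : metricType R} (G : reflexive_digraph X).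
Context (F : X * X -> X).
Implicit Types p q : X * X.

Definition sum_dist p q : R := mdist p.1 q.1 + mdist p.2 q.2.

Lemma sum_dist_triangle p q r : sum_dist p r <= sum_dist p q + sum_dist q r.
Proof. by rewrite /sum_dist addrACA lerD// metric_triangle. Qed.

(** [walk L p q]: some walk from [p] to [q] has total length at most [L].
    Concatenation is a constructor, rather than adding one edge at an end, so
    that replacing each edge by a walk is a direct induction. *)
Inductive walk : R -> X * X -> X * X -> Prop :=
| walk_edge L p q :
    edges (prod_digraph G) (p, q) -> sum_dist p q <= L -> walk L p q
| walk_cat L M p q r : walk L p q -> walk M q r -> walk (L + M) p r.

Lemma walk_dist L p q : walk L p q -> sum_dist p q <= L.
Proof.
elim=> // {L p q} L M p q r _ pq _ qr.
exact: le_trans (sum_dist_triangle p q r) (lerD pq qr).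
Qed.

Definition coupled_map p : X * X := (F (p.1, p.2), F (p.2, p.1)).

Context (F_mixed : mixed_monotone G F) (k : R).
Context (F_contraction : forall x y u v : X,
  edges (prod_digraph G) ((x, y), (u, v)) ->
  mdist (F (x, y)) (F (u, v)) <= k / 2 * (mdist x u + mdist y v)).

(** Reflexivity of the digraph lets the contraction hypothesis be applied when
    one coordinate stays put; only the moving coordinate is then charged. *)
Lemma contraction_fst x u y : edges G (x, u) ->
  mdist (F (x, y)) (F (u, y)) <= k / 2 * mdist x u.
Proof.
move=> xu; have := F_contraction (conj xu (edges_refl G y)).
by rewrite /= mdistxx addr0.
Qed.

Lemma contraction_snd x y v : edges G (v, y) ->
  mdist (F (x, y)) (F (x, v)) <= k / 2 * mdist y v.
Proof.
move=> vy; have := F_contraction (conj (edges_refl G x) vy).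
by rewrite /= mdistxx add0r.
Qed.

Lemma coupled_map_edge p q : edges (prod_digraph G) (p, q) ->
  walk (k * sum_dist p q) (coupled_map p) (coupled_map q).
Proof.
case: p q => [x y] [u v] [/= xu vy]; have [F1 F2] := F_mixed.
rewrite /sum_dist mulrDr /=.
apply: (@walk_cat _ _ _ (F (u, y), F (y, u))); apply: walk_edge.
- by split => /=; [exact: F1 | exact: F2].
- have := contraction_fst y xu; have := contraction_snd y xu.
  rewrite /sum_dist/= [mdist (F (y, u)) _]metric_sym [mdist u x]metric_sym; lra.
- by split => /=; [exact: F2 | exact: F1].
- have := contraction_snd u vy; have := contraction_fst u vy.
  rewrite /sum_dist/= [mdist (F (v, u)) _]metric_sym [mdist v y]metric_sym; lra.
Qed.

Lemma coupled_map_walk (k0 : 0 <= k) L p q :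
  walk L p q -> walk (k * L) (coupled_map p) (coupled_map q).
Proof.
elim=> {L p q} [L p q pq pqL|L M p q r _ pq _ qr]; last first.
  by rewrite mulrDr; exact: walk_cat pq qr.
(* A trivial walk absorbs the slack between the length of the edge and [L]. *)
rewrite -[L](subrKC (sum_dist p q)) mulrDr.
apply: walk_cat (coupled_map_edge pq) _.
apply: walk_edge; first exact: edges_refl.
by rewrite /sum_dist !mdistxx addr0 mulr_ge0// subr_ge0.
Qed.

Lemma coupled_map_iter_dist (k0 : 0 <= k) p n :
  edges (prod_digraph G) (p, coupled_map p) ->
  sum_dist (iter n coupled_map p) (iter n.+1 coupled_map p)
    <= sum_dist p (coupled_map p) * k ^+ n.
Proof.
move=> pTp; apply: walk_dist; rewrite mulrC.
elim: n => [|n IH]; first by rewrite mul1r; exact: walk_edge.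
by rewrite exprS -mulrA; exact: coupled_map_walk.
Qed.

End CoupledMap.

Lemma coupled_iter_limit (R : realType) (X : metricType R) (F : X * X -> X)
    (F_continuous : continuous F) (x y : nat -> X) (a b : X)
    (xE : forall n, x n.+1 = F (x n, y n)) :
  x @ \oo --> a -> y @ \oo --> b -> F (a, b) = a.
Proof.
move=> xa yb.
have Fab : (fun n => F (x n, y n)) @ \oo --> F (a, b).
  apply: (@cvg_comp _ _ _ (fun n => (x n, y n)) F); last exact: F_continuous.
  exact: cvg_pair xa yb.
apply: (cvg_unique (@metric_hausdorff _ X) Fab).
have -> : (fun n => F (x n, y n)) = (fun n => x n.+1) by apply/funext => n.
exact: (@cvg_comp _ _ _ (addn 1) x _ _ _ (cvg_addnl 1) xa).
Qed.

Theorem theorem3p1 (R : realType) (X : completeMetricType R)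
    (G : reflexive_digraph X) (F : X * X -> X)
    (F_continuous : continuous F)
    (F_mixed : mixed_monotone G F)
    (F_contraction : exists2 k : R, k < 1 &
       forall x y u v : X, edges (prod_digraph G) ((x, y), (u, v)) ->
         mdist (F (x, y)) (F (u, v)) <= k / 2 * (mdist x u + mdist y v))
    (F_start : exists x0 y0 : X,
       edges (prod_digraph G) ((x0, y0), (F (x0, y0), F (y0, x0)))) :
  exists p : X * X, coupled_fixed_point F p.
Proof.
have [k k1 Fk] := F_contraction; have [x0 [y0 start]] := F_start.
(* A negative [k] is replaced by 0, as the ratio of the geometric sequence. *)
pose q := Num.max k 0.
have q0 : 0 <= q by rewrite /q le_max lexx orbT.
have q1 : q < 1 by rewrite /q gt_max k1 ltr01.
have Fq x y u v : edges (prod_digraph G) ((x, y), (u, v)) ->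
    mdist (F (x, y)) (F (u, v)) <= q / 2 * (mdist x u + mdist y v).
  move=> /Fk /le_trans; apply; apply: ler_wpM2r.
    by rewrite addr_ge0 ?mdist_ge0.
  by rewrite ler_pM2r ?invr_gt0 ?ltr0n// /q le_max lexx.
pose z n := iter n (coupled_map F) (x0, y0).
have zstep n := coupled_map_iter_dist F_mixed Fq q0 n start.
have [a xa] : exists a : X, (fun n => (z n).1) @ \oo --> a.
  apply: (geometric_steps_cvg q0 q1) => n.
  by apply: le_trans (zstep n); rewrite lerDl mdist_ge0.
have [b yb] : exists b : X, (fun n => (z n).2) @ \oo --> b.
  apply: (geometric_steps_cvg q0 q1) => n.
  by apply: le_trans (zstep n); rewrite lerDr mdist_ge0.
exists (a, b); split => /=.
- by apply: (coupled_iter_limit F_continuous _ xa yb).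
- by apply: (coupled_iter_limit F_continuous _ yb xa).
Qed.
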